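(* Let $\mathbb{I}$ be a nonempty real interval, $n\geqslant1$, and $\mathsf{F}\colon\mathbb{I}^n\to\mathbb{R}$ a function. If there is at least one function $\mathsf{G}\colon\mathbb{I}^n\to\mathbb{I}$ with $\mathsf{F}=\delta_{\mathsf{F}}\circ\mathsf{G}$, then $\mathrm{ran}(\delta_{\mathsf{F}})=\mathrm{ran}(\mathsf{F})$. Under the Axiom of Choice (which is not necessary if $\delta_{\mathsf{F}}$ is monotonic), the converse also holds: if $\mathrm{ran}(\delta_{\mathsf{F}})=\mathrm{ran}(\mathsf{F})$, then there is a function $\mathsf{G}\colon\mathbb{I}^n\to\mathbb{I}$ with $\mathsf{F}=\delta_{\mathsf{F}}\circ\mathsf{G}$.
   Context: $\delta_{\mathsf{F}}\colon\mathbb{I}\to\mathbb{R}$, $\delta_{\mathsf{F}}(x)=\mathsf{F}(x,\ldots,x)$, is the diagonal section of $\mathsf{F}$; $\mathrm{ran}$ denotes range. Monotonic means either nondecreasing or nonincreasing. *)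

(* Defs.v *)
From Stdlib Require Import Reals Vector ChoiceFacts.
Local Open Scope R_scope.

(* Nonempty real intervals of every kind (open, closed, half-open, bounded or not,
   degenerate) are exactly the nonempty order-convex subsets of R. *)
Definition is_interval (I : R -> Prop) : Prop :=
  forall x y z : R, I x -> I z -> x <= y <= z -> I y.

Definition elt (I : R -> Prop) : Type := {x : R | I x}.

Definition power (I : R -> Prop) (n : nat) : Type := Vector.t (elt I) n.

Definition diag {I : R -> Prop} {n : nat} (F : power I n -> R) : elt I -> R :=
  fun x => F (Vector.const x n).

Definition ran {A : Type} (f : A -> R) : R -> Prop :=
  fun y => exists x : A, f x = y.

Definition same_ran {A B : Type} (f : A -> R) (g : B -> R) : Prop :=
  forall y : R, ran f y <-> ran g y.

Definition nondecreasing {I : R -> Prop} (f : elt I -> R) : Prop :=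
  forall x y : elt I, proj1_sig x <= proj1_sig y -> f x <= f y.

Definition nonincreasing {I : R -> Prop} (f : elt I -> R) : Prop :=
  forall x y : elt I, proj1_sig x <= proj1_sig y -> f y <= f x.

Definition monotonic {I : R -> Prop} (f : elt I -> R) : Prop :=
  nondecreasing f \/ nonincreasing f.

Definition factors_through_diag {I : R -> Prop} {n : nat}
    (F : power I n -> R) : Prop :=
  exists G : power I n -> elt I, forall x : power I n, F x = diag F (G x).

(* The axiom of choice, as a proposition to be assumed explicitly where it is
   used rather than taken from the ambient logic. *)
Definition axiom_of_choice : Prop := FunctionalChoice.

(* Main.v *)
Require Import Defs.
From Stdlib Require Import Reals Lra Classical_Prop.
Local Open Scope R_scope.

(** Write [f] for the diagonal section of [F].  Always [ran f] is contained in
    [ran F], and a factorization [F = f o G] gives the other inclusion.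
    Conversely, when [ran F] is contained in [ran f], every fibre
    [{t | f t = F x}] is nonempty, and the required [G] is a selection of one
    point in each of these fibres ([section_of_selector]).

    The axiom of choice supplies a selection at once.  When [f] is monotonic
    it can be avoided: the fibres of [f] are then intervals
    ([monotonic_fibre_interval]), and a point of a nonempty interval can be
    described explicitly in terms of suprema ([interval_point]).  Excluded
    middle is used there only to check that the described point lies in the
    interval; the point itself comes from the completeness of the reals, so the
    monotonic case rests on no choice principle. *)

Lemma lub_approx (E : R -> Prop) (s t : R) :
  is_lub E s -> t < s -> exists x, E x /\ t < x.
Proof.
  intros [_ least] ts; apply NNPP; intros none.
  assert (s <= t); [| lra].
  apply least; intros x Ex.
  destruct (Rle_or_lt x t) as [| tx]; [assumption |].
  exfalso; apply none; now exists x.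
Qed.

(** A choice function on nonempty intervals, defined without choice.  The
    midpoint of an interval would do if it were bounded, so the midpoint is
    taken after the order isomorphism [atan] has made the interval bounded, and
    is carried back by [tan].  If the midpoint differs from the image of some
    point of the interval, then it lies strictly between the images of two
    points of the interval, and convexity applies. *)
Lemma interval_point (A : R -> Prop) :
  is_interval A -> (exists a, A a) -> {t : R | A t}.
Proof.
  intros convA neA.
  set (U := fun y => exists a, A a /\ y = atan a).
  set (L := fun y => exists a, A a /\ y = - atan a).
  destruct (completeness U) as [s lub_s].
  { exists (PI / 2); intros y (a & _ & ->).
    pose proof (atan_bound a); lra. }
  { destruct neA as [a Aa]; exists (atan a), a; auto. }
  destruct (completeness L) as [i lub_i].
  { exists (PI / 2); intros y (a & _ & ->).
    pose proof (atan_bound a); lra. }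
  { destruct neA as [a Aa]; exists (- atan a), a; auto. }
  (* [- i] is the infimum of [U]. *)
  set (m := (s - i) / 2).
  exists (tan m).
  assert (between : forall a b, A a -> A b -> atan a < m < atan b -> A (tan m)).
  { intros a b Aa Ab [am mb].
    pose proof (atan_bound a); pose proof (atan_bound b).
    apply (convA a _ b Aa Ab); split; apply Rlt_le.
    - rewrite <- (tan_atan a); apply tan_increasing; lra.
    - rewrite <- (tan_atan b); apply tan_increasing; lra. }
  destruct neA as [a Aa].
  assert (a_le_s : atan a <= s) by (apply lub_s; exists a; auto).
  assert (i_le_a : - atan a <= i) by (apply lub_i; exists a; auto).
  destruct (Rtotal_order m (atan a)) as [ma | [ma | am]].
  - destruct (lub_approx L i (- m) lub_i) as (y & (b & Ab & ->) & mb);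
      [unfold m in *; lra |].
    apply (between b a); auto; lra.
  - now rewrite ma, tan_atan.
  - destruct (lub_approx U s m lub_s) as (y & (b & Ab & ->) & mb);
      [unfold m in *; lra |].
    apply (between a b); auto.
Qed.

Definition fibre {I : R -> Prop} (f : elt I -> R) (y : R) : R -> Prop :=
  fun t => exists p : elt I, proj1_sig p = t /\ f p = y.

(** Points of [elt I] carry a membership proof.  A monotonic function cannot
    see it, by the two inequalities coming from [t <= t]. *)
Lemma monotonic_ext {I : R -> Prop} (f : elt I -> R) (p q : elt I) :
  monotonic f -> proj1_sig p = proj1_sig q -> f p = f q.
Proof.
  intros [mono | mono] pq; apply Rle_antisym; apply mono; lra.
Qed.

(** The values of [f] between two points of a fibre are squeezed between two
    equal values. *)
Lemma monotonic_fibre_interval {I : R -> Prop} (f : elt I -> R) (y : R) :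
  is_interval I -> monotonic f -> is_interval (fibre f y).
Proof.
  intros convI mono u t v ([u' Iu] & <- & fu) ([v' Iv] & <- & fv) utv.
  simpl in utv.
  exists (exist _ t (convI _ _ _ Iu Iv utv)); split; [reflexivity |].
  destruct mono as [mono | mono]; apply Rle_antisym.
  - rewrite <- fv; apply mono; simpl; lra.
  - rewrite <- fu; apply mono; simpl; lra.
  - rewrite <- fu; apply mono; simpl; lra.
  - rewrite <- fv; apply mono; simpl; lra.
Qed.

(** The selected point is informative data ([sig]), obtained from the mere
    existence of a preimage; this is what allows [G] to be built without
    choice. *)
Lemma monotonic_preimage {I : R -> Prop} (f : elt I -> R) (y : R) :
  is_interval I -> monotonic f -> ran f y -> {p : elt I | f p = y}.
Proof.
  intros convI mono ran_y.
  destruct (interval_point (fibre f y)) as [t fibre_t].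
  { now apply monotonic_fibre_interval. }
  { destruct ran_y as [p fp]; exists (proj1_sig p), p; auto. }
  assert (It : I t).
  { destruct fibre_t as ([u Iu] & <- & _); exact Iu. }
  exists (exist _ t It).
  destruct fibre_t as (p & pt & <-).
  apply monotonic_ext; auto.
Qed.

Lemma section_of_selector {I : R -> Prop} {n : nat} (F : power I n -> R) :
  (forall x, {p : elt I | diag F p = F x}) -> factors_through_diag F.
Proof.
  intros sel; exists (fun x => proj1_sig (sel x)); intros x.
  symmetry; apply (proj2_sig (sel x)).
Qed.

Lemma same_ran_preimage {A B : Type} (f : A -> R) (g : B -> R) :
  same_ran f g -> forall x, ran f (g x).
Proof.
  intros same x; apply same; now exists x.
Qed.

Lemma factors_same_ran {I : R -> Prop} {n : nat} (F : power I n -> R) :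
  factors_through_diag F -> same_ran (diag F) F.
Proof.
  intros [G FG] y; split; intros [x <-].
  - now exists (Vector.const x n).
  - now exists (G x).
Qed.

Theorem proposition2p1
    (I : R -> Prop) (I_interval : is_interval I) (I_nonempty : exists x : R, I x)
    (n : nat) (n_ge1 : (1 <= n)%nat) (F : power I n -> R) :
  (factors_through_diag F -> same_ran (diag F) F) /\
  (axiom_of_choice -> same_ran (diag F) F -> factors_through_diag F) /\
  (monotonic (diag F) -> same_ran (diag F) F -> factors_through_diag F).
Proof.
  split; [apply factors_same_ran | split].
  - intros AC same.
    destruct (AC _ _ (fun x p => diag F p = F x) (same_ran_preimage _ _ same))
      as [G FG].
    apply section_of_selector; intros x; exists (G x); apply FG.
  - intros mono same.
    apply section_of_selector; intros x.
    apply monotonic_preimage; auto using same_ran_preimage.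
Qed.
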